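(* Let $p$ and $q$ be primes with $p = 2q+1$. Let $K = \langle k_1\rangle \times \langle k_2 \rangle \times \cdots \times \langle k_p\rangle$ be the direct product of $p$ cyclic groups of order $p$, let $N = \langle k_1 k_2 \cdots k_p\rangle$, and let $H = K/N$. In the symmetric group $\mathrm{Sym}_p$, let $\alpha = (1\,2\,\ldots\,p)$, $A = \langle \alpha \rangle$, and let $\beta = (m_1 \ldots m_q)(n_1 \ldots n_q)$ where $\{m_1,\ldots,m_q,n_1,\ldots,n_q\} = \{2,3,\ldots,p\}$, and $B = \langle \beta\rangle$; assume moreover that $\alpha^{\beta} = \alpha^{r}$ for some integer $r$ with $1 < r < q$ and $r^q \equiv 1 \pmod p$, so that $A \rtimes B$ is a subgroup of $\mathrm{Sym}_p$. Let $A \rtimes B$ act on $H$ by permuting indices: for $\gamma \in A\rtimes B$ and integers $x_1,\ldots,x_p$, $$(k_1^{x_1}k_2^{x_2}\cdots k_p^{x_p}N)^{\gamma} = k_{1^{\gamma}}^{x_1}k_{2^{\gamma}}^{x_2}\cdots k_{p^{\gamma}}^{x_p}N,$$ and let $G = H \rtimes (A \rtimes B)$ be the corresponding semidirect product. Then $$\mathrm{N}(G) = \{1, p, p^{p-2}\} \times \{1, q\}$$ and $Z(G) = 1$.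
   Context: For a finite group $G$, $\mathrm{N}(G)$ denotes the set of conjugacy class sizes of $G$, i.e. $\{|G : C_G(x)| : x \in G\}$. For sets of positive integers $\Omega,\Delta$, $\Omega \times \Delta$ denotes the set of products $\{\omega\delta : \omega \in \Omega, \delta \in \Delta\}$. $Z(G)$ is the center of $G$. $i^{\gamma}$ denotes the image of $i \in \{1,\ldots,p\}$ under the permutation $\gamma$ (permutations act on the right), and $\alpha^\beta = \beta^{-1}\alpha\beta$. *)

(* Defs.v *)
From HB Require Import structures.
From mathcomp Require Import all_boot all_algebra all_fingroup all_solvable.
Set Implicit Arguments. Unset Strict Implicit. Unset Printing Implicit Defensive.
Import GRing.Theory.

Section Construction.
Variable p : nat.

(* K = the direct product of p cyclic groups of order p, as Z_p^p (additive) *)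
Definition vecK : finGroupType := 'rV['Z_p]_p.

Definition kgen (i : 'I_p) : vecK := delta_mx ord0 i.

Definition Ngrp : {group vecK} := <[ (\prod_(i < p) kgen i)%g ]>%G.

(* permutation of indices: (k_i^{x_i})^g = k_{i^g}^{x_i} *)
Definition permact (v : vecK) (g : {perm 'I_p}) : vecK := (\row_j (v : 'rV_p) ord0 (g^-1 j)%g)%R.

Lemma permact1 : permact^~ 1%g =1 id.
Proof. by move=> v; apply/rowP=> j; rewrite mxE invg1 perm1. Qed.

Lemma permactM : forall v, act_morph permact v.
Proof.
by move=> v g h; apply/rowP=> j; rewrite !mxE invMg permM.
Qed.

Definition permact_action := TotalAction permact1 permactM.

Lemma permact_is_groupAction : is_groupAction [set: vecK] permact_action.
Proof.
move=> g _; rewrite inE; apply/andP; split.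
  by apply/subsetP=> x; rewrite inE.
apply/morphicP=> u v _ _; rewrite !actpermE /=.
by apply/rowP=> j; rewrite !mxE.
Qed.

Definition permact_gaction := GroupAction permact_is_groupAction.

Definition Haction := quotient_groupAction permact_gaction Ngrp.

Lemma Ngen_entry j : ((\prod_(i < p) kgen i)%g : 'rV['Z_p]_p) ord0 j = 1%R.
Proof.
have -> : ((\prod_(i < p) kgen i)%g : 'rV['Z_p]_p) = (\sum_(i < p) delta_mx ord0 i)%R.
  by apply: (big_rec2 (fun (x : vecK) (y : 'rV['Z_p]_p) => x = y)) => // i x y _ ->.
rewrite summxE (bigD1 j) //= mxE !eqxx big1 ?addr0 // => i /negbTE ij.
by rewrite mxE eq_sym ij andbF.
Qed.

Lemma permact_Ngen g : permact (\prod_(i < p) kgen i)%g g = (\prod_(i < p) kgen i)%g.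
Proof. by apply/rowP=> j; rewrite mxE !Ngen_entry. Qed.

Lemma qdom_full : [set: {perm 'I_p}] \subset qact_dom permact_action Ngrp.
Proof.
rewrite (@qact_domE _ _ _ _ permact_gaction) ?subsetT //.
apply/subsetP=> g _; rewrite !inE /=.
apply/subsetP=> x /cycleP[m ->]; rewrite inE.
have := @gactX _ _ _ _ permact_gaction g (in_setT g) m (\prod_(i < p) kgen i)%g (in_setT _); rewrite /= => ->.
by rewrite permact_Ngen mem_cycle.
Qed.

(* alpha = (1 2 ... p); indices 1..p are represented by 0..p-1 *)
Definition alpha : {perm 'I_p} := perm (can_inj (@ordSK p)).

Definition ABgrp (beta : {perm 'I_p}) : {group {perm 'I_p}} :=
  (<[alpha]> <*> <[beta]>)%G.

Definition Hact (beta : {perm 'I_p}) :=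
  ract_groupAction Haction (subset_trans (subsetT (ABgrp beta)) qdom_full).

Definition Gtype (beta : {perm 'I_p}) : finGroupType := sdprod_by (Hact beta).
Definition Ggrp (beta : {perm 'I_p}) : {group Gtype beta} := [set: Gtype beta]%G.

End Construction.

Definition class_sizes (gT : finGroupType) (G : {set gT}) : seq nat :=
  [seq #|G : 'C_G[x]|%g | x in G].

Definition set_prod (Om De : seq nat) : seq nat :=
  [seq a * b | a <- Om, b <- De].

(* Main.v *)
Require Import Defs.
From HB Require Import structures.
From mathcomp Require Import all_boot all_algebra all_fingroup all_solvable.

(** Write [L = A ><| B], a centreless group of order [pq], and let [x] be the
    [L]-part of [g]. If [x <> 1], then ['C_L[x]] has prime order, so it is
    generated by [x] and is the image of ['C_G[g]] in [L]; as [H] is abelian,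
    [#|'C_G[g]| = #|'C_H[x]| * #[x]]. By Sylow, [<[x]>] is conjugate to [A] or
    [B]. Viewing [H] as functions on [Z/p] modulo constants, ['C_H(A)] consists
    of the affine functions and ['C_H(B)] of the functions constant on the three
    orbits of [beta], so these have orders [p] and [p ^ 2] and meet trivially.
    If [x = 1], the class size is an index in [L]; the value [pq] occurs because
    the subgroups ['C_H[x]] with [x <> 1] are too small to cover [H]. *)

Set Implicit Arguments.
Unset Strict Implicit.

Import GRing.Theory.

Lemma dvdn_prime_mul (p q d : nat) : prime p -> prime q -> d %| p * q ->
  [\/ d = 1, d = p, d = q | d = p * q].
Proof.
move=> p_pr q_pr dpq; have [/dvdnP[k def_d] | p'd] := boolP (p %| d).
  move: dpq; rewrite def_d mulnC dvdn_pmul2l ?prime_gt0 //.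
  by case: (primeP q_pr) => _ h /h /orP[]/eqP->; rewrite ?muln1;
    [constructor 2 | constructor 4].
have: d %| q by rewrite -(@Gauss_dvdr d p) // coprime_sym prime_coprime.
by case: (primeP q_pr) => _ h /h /orP[]/eqP->; [constructor 1 | constructor 3].
Qed.

(** * Centralizers in a centreless group whose order is a product of two primes *)

Section CentrelessOrderPQ.

Variables (gT : finGroupType) (L : {group gT}) (p q : nat).
Hypotheses (p_pr : prime p) (q_pr : prime q).
Hypotheses (oL : #|L| = (p * q)%N) (Z1 : ('Z(L) = 1)%g).

(** The centralizer is proper because ['Z(L)] is trivial and nontrivial because it contains [x]; by
    Lagrange its order is prime, so [<[x]>] fills it. *)
Lemma centreless_pq_cent1 x : x \in (L^#)%g ->
  (#[x]%g = p \/ #[x]%g = q) /\ #|'C_L[x]%g| = #[x]%g.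
Proof.
case/setD1P=> x1 Lx.
have ltCL : #|'C_L[x]%g| <> (p * q)%N.
  move=> oC; have /setIidPl sLCx : 'C_L[x]%g = L.
    by apply/eqP; rewrite eqEcard subsetIl oC oL /=.
  have: x \in ('Z(L))%g by rewrite inE Lx -sub_cent1.
  by rewrite Z1 inE (negPf x1).
have xC : (<[x]> \subset 'C_L[x])%g by rewrite cycle_subG inE Lx cent1id.
have dC : #|'C_L[x]%g| %| p * q by rewrite -oL cardSg ?subsetIl.
have dx := cardSg xC; rewrite -/(order x) in dx.
have ox1 : #[x]%g != 1 by rewrite order_eq1.
case: (dvdn_prime_mul p_pr q_pr dC) => // oC; rewrite oC in dx *.
- by rewrite dvdn1 (negPf ox1) in dx.
- by case: (primeP p_pr) => _ /(_ _ dx) /orP[] /eqP e; [rewrite e in ox1 | split; [left|]].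
- by case: (primeP q_pr) => _ /(_ _ dx) /orP[] /eqP e; [rewrite e in ox1 | split; [right|]].
Qed.

End CentrelessOrderPQ.

Lemma order_Sylow (gT : finGroupType) (L X : {group gT}) (s t : nat) : prime s -> coprime s t ->
  #|L| = (s * t)%N -> X \subset L -> #|X| = s -> (s.-Sylow(L) X)%g.
Proof.
move=> s_pr cst oLst sXL oX; rewrite pHallE sXL oX oLst /=.
have t_gt0 : 0 < t by have := cardG_gt0 L; rewrite oLst muln_gt0 => /andP[].
by rewrite partnM ?(prime_gt0 s_pr) // part_pnat_id ?pnat_id // part_p'nat ?muln1 // p'natE // -prime_coprime.
Qed.


Lemma leq_card_bigcup (I T : finType) (A : {set I}) (F : I -> {set T}) (m : nat) :
  (forall i, i \in A -> #|F i| <= m) -> #|\bigcup_(i in A) F i| <= #|A| * m.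
Proof.
move=> leFm; rewrite -sum_nat_const.
apply: (big_rec2 (fun (X : {set T}) n => #|X| <= n)) => [|i n X Ai leXn]; first by rewrite cards0.
by apply: leq_trans (leq_card_setU _ _) _; rewrite leq_add ?leFm.
Qed.

(** * Class sizes and centre of a split extension of an abelian group by a centreless group of order
    [p * q] *)

Section AbelianByCentrelessPQ.

Local Open Scope group_scope.

Variables (gT : finGroupType) (G H L A B : {group gT}) (p q : nat).
Hypotheses (p_pr : prime p) (q_pr : prime q) (p_gt4 : 4 < p) (q_ltp : q < p).
Hypotheses (defG : H ><| L = G) (abH : abelian H) (oH : #|H| = (p ^ p.-1)%N).
Hypotheses (oL : #|L| = (p * q)%N) (ZL : 'Z(L) = 1).
Hypotheses (sAL : A \subset L) (oA : #|A| = p) (oCA : #|'C_H(A)| = p).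
Hypotheses (sBL : B \subset L) (oB : #|B| = q) (oCB : #|'C_H(B)| = (p ^ 2)%N).
Hypothesis (CHL : 'C_H(L) = 1).

Let nsHG : H <| G. Proof. by case/sdprod_context: defG. Qed.
Let sLG : L \subset G. Proof. by case/sdprod_context: defG. Qed.
Let nHL : L \subset 'N(H). Proof. by case/sdprod_context: defG. Qed.
Let p_neq_q : p != q. Proof. by rewrite neq_ltn q_ltp orbT. Qed.
Let cpq : coprime p q. Proof. by rewrite prime_coprime // dvdn_prime2. Qed.

(** Both [<[x]>] and [X] are Sylow [s]-subgroups of [L], hence conjugate by some [y] in [L]; as [y]
    normalizes [H], it carries one fixed-point subgroup onto the other. *)
Let cent1H_Sylow (s t : nat) (X : {group gT}) x : prime s -> coprime s t ->
  #|L| = (s * t)%N -> X \subset L -> #|X| = s -> x \in L -> #[x] = s ->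
  #|'C_H[x]| = #|'C_H(X)|.
Proof.
move=> s_pr cst oLst sXL oX Lx ox.
have sylX := order_Sylow s_pr cst oLst sXL oX.
have sxL : <[x]> \subset L by rewrite cycle_subG.
have sylx := order_Sylow s_pr cst oLst sxL ox.
have [y Ly defx] := Sylow_trans sylX sylx.
rewrite -cent_cycle -[<[x]>]/(gval <[x]>%G) defx.
have nHy : y \in 'N(H) by apply: (subsetP nHL).
by rewrite centJ -{1}(normP nHy) -conjIg cardJg.
Qed.

Lemma card_cent1H x : x \in L^# ->
  (#[x] = p /\ #|'C_H[x]| = p) \/ (#[x] = q /\ #|'C_H[x]| = (p ^ 2)%N).
Proof.
move=> L1x; have [ox _] := centreless_pq_cent1 p_pr q_pr oL ZL L1x.
have Lx : x \in L by case/setD1P: L1x.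
case: ox => ox; [left | right]; split=> //.
  by rewrite (@cent1H_Sylow p q A).
by rewrite (@cent1H_Sylow q p B) // ?(coprime_sym q) // oL mulnC.
Qed.

(** Lagrange is applied to ['C_G[h * x]] and its intersection with [H]. The intersection is
    ['C_H[x]] because [h] commutes with [H]; the image in [G / H] is generated by the coset of
    [x]. *)
Lemma card_cent1_sdprod h x : h \in H -> x \in L^# ->
  #|'C_G[h * x]| = (#|'C_H[x]| * #[x])%N.
Proof.
move=> Hh L1x; have [x1 Lx] := setD1P L1x.
have [_ _ _ _ tiHL] := sdprod_context defG.
have nHG := normal_norm nsHG; have sHG := normal_sub nsHG.
have nHx : x \in 'N(H) by apply: (subsetP nHL).
have isoL : L \isog G / H := sdprod_isog defG.
have oLH : #|G / H| = (p * q)%N by rewrite -(card_isog isoL).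
have ZLH : 'Z(G / H) = 1.
  by apply/eqP; have := isog_eq1 (isog_center isoL); rewrite /= ZL eqxx => <-.
have cosetE : coset H (h * x) = coset H x.
  by rewrite morphM ?(subsetP (normG H) _ Hh) //= coset_id // mul1g.
have ocx : #[coset H x] = #[x].
  have inj : 'injm (restrm nHL (coset H)) by rewrite ker_restrm ker_coset setIC tiHL.
  exact: (order_injm inj).
have GHx : coset H x \in (G / H)^#.
  by rewrite !inE -order_eq1 ocx order_eq1 x1 mem_quotient ?(subsetP sLG _ Lx).
have [_ oC] := centreless_pq_cent1 p_pr q_pr oLH ZLH GHx.
have Gg : h * x \in G by rewrite groupM // ?(subsetP sHG _ Hh) ?(subsetP sLG _ Lx).
have CHg : 'C_G[h * x] :&: H = 'C_H[x].
  rewrite setIAC (setIidPr sHG); apply/setP=> y; rewrite !in_setI.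
  case Hy: (y \in H) => //=; rewrite !cent1E.
  have chy : h * y = y * h by apply: (centsP abH).
  apply/eqP/eqP => [|e]; last by rewrite mulgA -chy -!mulgA e.
  by rewrite mulgA -chy -!mulgA => /mulgI.
have nHC : 'C_G[h * x] \subset 'N(H) by apply: subset_trans (subsetIl _ _) nHG.
rewrite -(LagrangeI _ H) CHg -card_quotient //; congr (_ * _)%N.
(* Upper bound: the image centralizes the coset of [x], whose centralizer in [G / H] has order
   [#[x]]. Lower bound: the image contains that coset. *)
apply/eqP; rewrite eqn_leq -{1}ocx -oC -cosetE subset_leq_card ?quotient_subcent1 //=.
rewrite -ocx -cosetE subset_leq_card // cycle_subG mem_quotient //.
by rewrite inE Gg cent1id.
Qed.

(** Two factors [p] are split off so that centralizer orders [p * p] and [p ^ 2 * q] cancel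
    directly. *)
Let oG : #|G| = (p ^ (p - 2) * p * p * q)%N.
Proof.
rewrite -(sdprod_card defG) oH oL mulnA; congr (_ * _ * _)%N.
by rewrite -expnSr subn2; case: p p_gt4 => [|[|n]].
Qed.

Lemma class_size_sdprod h x : h \in H -> x \in L^# ->
  (#[x] = p /\ #|G : 'C_G[h * x]| = (p ^ (p - 2) * q)%N) \/
  (#[x] = q /\ #|G : 'C_G[h * x]| = (p ^ (p - 2))%N).
Proof.
move=> Hh L1x; have p_gt0 := prime_gt0 p_pr; have q_gt0 := prime_gt0 q_pr.
rewrite -divgS ?subsetIl // card_cent1_sdprod // oG.
have [[-> ->]|[-> ->]] := card_cent1H L1x; [left | right]; split=> //.
  by rewrite mulnAC (mulnAC _ p q) -(mulnA _ p p) mulnK // muln_gt0 p_gt0.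
by rewrite -(mulnA _ p p) mulnn -mulnA mulnK // muln_gt0 expn_gt0 p_gt0.
Qed.

(** Since [H] is abelian it centralizes [h], so the modular law gives ['C_G[h] = H * 'C_L[h]], and
    [#|H|] cancels in the index. *)
Lemma class_size_kernel h : h \in H -> #|G : 'C_G[h]| = #|L : 'C_L[h]|.
Proof.
move=> Hh; have [_ defHL _ tiHL] := sdprodP defG.
have sHC : H \subset 'C[h] by rewrite sub_cent1 (subsetP abH).
have defC : 'C_G[h] = H * 'C_L[h] by rewrite group_modl // defHL.
rewrite -!divgS ?subsetIl // -(sdprod_card defG) /= defC TI_cardMg.
  by rewrite divnMl // cardG_gt0.
by apply/trivgP; rewrite -tiHL setIS // subsetIl.
Qed.

Lemma cent1L_proper h : h \in H^# -> #|'C_L[h]| <> (p * q)%N.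
Proof.
case/setD1P=> h1 Hh oC; have: h \in 'C_H(L).
  rewrite inE Hh -sub_cent1; apply/setIidPl/eqP.
  by rewrite eqEcard subsetIl oC oL /=.
by rewrite CHL inE (negPf h1).
Qed.

(** Otherwise [H] is the union of the subgroups ['C_H[x]] over [L^#]: fewer than [p * q <= p ^ 2]
    sets, each of order at most [p ^ 2]. They hold fewer than [p ^ 4 <= p ^ p.-1] elements, as
    [4 < p]. *)
Lemma exists_regular_kernel : exists2 h, h \in H & 'C_L[h] = 1.
Proof.
have [/existsP[h /andP[Hh /eqP Ch]] | no_h] := boolP [exists h, (h \in H) && ('C_L[h] == 1)].
  by exists h.
have: H \subset \bigcup_(x in L^#) 'C_H[x].
  apply/subsetP=> h Hh; move: no_h; rewrite negb_exists => /forallP/(_ h).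
  rewrite Hh /= => /trivgPn[x /setIP[Lx cxh] x1].
  by apply/bigcupP; exists x; rewrite ?in_setD1 ?x1 // in_setI Hh cent1C.
move/subset_leq_card; rewrite leqNgt; case/negP; rewrite oH.
have p_gt0 := prime_gt0 p_pr; have p_gt1 := prime_gt1 p_pr.
have leC x : x \in L^# -> #|'C_H[x]| <= p ^ 2.
  by case/card_cent1H => [] [_ ->]; rewrite // -{1}(expn1 p) leq_exp2l.
apply: leq_ltn_trans (leq_card_bigcup leC) _.
rewrite (leq_trans (n := p ^ 4)) // ?leq_exp2l //; last by rewrite -ltnS prednK.
rewrite (expnD p 2 2) ltn_pmul2r ?expn_gt0 ?p_gt0 //.
apply: (@leq_trans (p * q)); last by rewrite -mulnn leq_mul2l (ltnW q_ltp) orbT.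
by rewrite -oL (cardsD1 1 L) group1.
Qed.

Lemma class_sizes_sdprod : class_sizes G =i set_prod [:: 1%N; p; p ^ (p - 2)]%N [:: 1%N; q].
Proof.
have p_gt0 := prime_gt0 p_pr; have q_gt0 := prime_gt0 q_pr.
have p_gt1 := prime_gt1 p_pr; have q_gt1 := prime_gt1 q_pr.
have [_ defHL _ _] := sdprodP defG.
have memG g n : g \in G -> #|G : 'C_G[g]| = n -> n \in class_sizes G.
  by move=> Gg <-; apply: image_f.
have exX (X : {group gT}) : 1 < #|X| -> exists2 x, x \in X & x != 1.
  by rewrite cardG_gt1 => /trivgPn.
(* A nontrivial [h] in ['C_H(X)] has [X] inside ['C_L[h]], which is not all of [L]; so ['C_L[h]] has
   order [s] and the class of [h] has size [t]. *)
have sizeL (X : {group gT}) s t : prime s -> prime t -> (p * q = s * t)%N ->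
    X \subset L -> #|X| = s -> 1 < #|'C_H(X)| -> t \in class_sizes G.
  move=> s_pr t_pr est sXL oX /exX[h /setIP[Hh cXh] h1].
  apply: (@memG h); first exact: (subsetP (normal_sub nsHG)).
  have sXC : X \subset 'C_L[h] by rewrite subsetI sXL sub_cent1.
  have H1h : h \in H^# by rewrite !inE h1.
  have oLst : #|L| = (s * t)%N by rewrite oL.
  rewrite class_size_kernel // -divgS ?subsetIl // oLst.
  have := cent1L_proper H1h; rewrite est.
  have /dvdnP[k oC] := cardSg sXC; rewrite oX in oC.
  have: #|'C_L[h]| %| #|L| by rewrite cardSg ?subsetIl.
  rewrite oC oLst mulnC dvdn_pmul2l ?prime_gt0 //.
  case: (primeP t_pr) => _ dvt /dvt /orP[]/eqP->; last by [].
  by rewrite muln1 mulKn ?prime_gt0.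
move=> n; rewrite /set_prod /=; apply/idP/idP.
  case/imageP=> g; rewrite inE => Gg ->.
  have: g \in H * L by rewrite defHL.
  case/mulsgP=> h x Hh Lx ->; have [x1 | x1] := eqVneq x 1.
    rewrite x1 mulg1 class_size_kernel // -divgS ?subsetIl //.
    have: #|'C_L[h]| %| p * q by rewrite -oL cardSg ?subsetIl.
    rewrite oL; case/(dvdn_prime_mul p_pr q_pr) => ->;
     by rewrite ?divn1 ?mulKn ?mulnK ?divnn ?muln_gt0 ?p_gt0 ?q_gt0 //= !inE ?muln1 ?mul1n eqxx ?orbT.
  have L1x : x \in L^# by rewrite !inE x1.
  by case: (class_size_sdprod Hh L1x) => [] [_ ->]; rewrite !inE ?muln1 eqxx ?orbT.
have oGen (X : {group gT}) : 1 < #|X| -> X \subset L -> exists2 x, x \in L^# & #[x] %| #|X|.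
  move=> /exX[x Xx x1] sXL; exists x; last exact: order_dvdG.
  by rewrite !inE x1 (subsetP sXL).
have hp x : x \in L^# -> #[x] %| p -> (p ^ (p - 2) * q)%N \in class_sizes G.
  move=> L1x dx; have Gx : x \in G by case/setD1P: L1x => _ /(subsetP sLG).
  apply: (@memG x) => //; have [[_ ] | [ox]] := class_size_sdprod (group1 H) L1x; rewrite mul1g //.
  by move: dx; rewrite ox dvdn_prime2 // eq_sym (negPf p_neq_q).
have hq x : x \in L^# -> #[x] %| q -> (p ^ (p - 2))%N \in class_sizes G.
  move=> L1x dx; have Gx : x \in G by case/setD1P: L1x => _ /(subsetP sLG).
  apply: (@memG x) => //; have [[ox] | [_ ]] := class_size_sdprod (group1 H) L1x; rewrite mul1g //.
  by move: dx; rewrite ox dvdn_prime2 // (negPf p_neq_q).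
(* The sizes come in the order 1, [q], [p], [p * q], [p ^ (p - 2)], [p ^ (p - 2) * q]. Their
   witnesses are the identity, a fixed point of [A], a fixed point of [B], a regular element of [H],
   and nontrivial elements of [B] and of [A]. *)
rewrite !inE ?muln1 ?mul1n => /or4P[||| /or3P[||]] /eqP->.
- apply: (@memG 1); first exact: group1.
  by rewrite class_size_kernel // cent11T setIT indexgg.
- by apply: (sizeL A p q); rewrite ?oCA.
- apply: (sizeL B q p); rewrite ?oCB ?(mulnC p) //.
  by rewrite -(expn0 p) ltn_exp2l.
- have [h Hh Ch] := exists_regular_kernel; apply: (@memG h); first exact: (subsetP (normal_sub nsHG)).
  by rewrite class_size_kernel // Ch indexg1.
- by have [||x L1x dx] := oGen B; rewrite ?oB //; apply: (hq x); rewrite -?oB.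
- by have [||x L1x dx] := oGen A; rewrite ?oA //; apply: (hp x); rewrite -?oA.
Qed.

(** A central element in [H] lies in ['C_H(L) = 1]; one with a nontrivial [L]-part would have class
    size at least [p ^ (p - 2) > 1]. *)
Lemma center_sdprod : 'Z(G) = 1.
Proof.
apply/trivgP/subsetP=> z /centerP[Gz cGz].
have [_ defHL _ _] := sdprodP defG.
have: z \in H * L by rewrite defHL.
case/mulsgP=> h x Hh Lx def_z; have [x1 | x1] := eqVneq x 1.
  rewrite -[1]CHL inE def_z x1 mulg1 Hh; apply/centP=> y Ly.
  have := cGz _ (subsetP sLG _ Ly); rewrite def_z x1 mulg1; exact.
have L1x : x \in L^# by rewrite !inE x1.
have := class_size_sdprod Hh L1x; rewrite -def_z.
have -> : 'C_G[z] = G.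
  by apply/setIidPl; rewrite sub_cent1; apply/centP=> y /cGz.
rewrite indexgg; have: 1 < p ^ (p - 2).
  by rewrite -(expn0 p) ltn_exp2l ?prime_gt1 // subn_gt0 ltnW // ltnW.
case=> P1 [] [_ /esym/eqP]; first rewrite muln_eq1 => /andP[].
  by case/eqP => e; rewrite e in P1.
by case/eqP => e; rewrite e in P1.
Qed.

End AbelianByCentrelessPQ.

(** A nontrivial centre leaves a central quotient of order 1, [p] or [q], which is cyclic and makes
    [L] abelian. *)
Lemma nonabelian_pq_center (gT : finGroupType) (L : {group gT}) (p q : nat) :
  prime p -> prime q -> #|L| = p * q -> ~~ abelian L -> ('Z(L) = 1)%g.
Proof.
move=> p_pr q_pr oL nabL; apply/eqP; apply: contraR nabL => ntZ.
apply: cyclic_center_factor_abelian; have nZL := normal_norm (center_normal L).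
have: #|'Z(L)%g| * #|(L / 'Z(L))%g| = p * q.
  by rewrite card_quotient // -oL Lagrange // center_sub.
have dZ : #|'Z(L)%g| %| p * q by rewrite -oL cardSg ?center_sub.
have p_gt0 := prime_gt0 p_pr; have q_gt0 := prime_gt0 q_pr.
case: (dvdn_prime_mul p_pr q_pr dZ) => oZ; rewrite oZ => /eqP.
- by rewrite trivg_card1 oZ in ntZ.
- by rewrite eqn_pmul2l // => /eqP o; rewrite prime_cyclic ?o.
- by rewrite mulnC eqn_pmul2r // => /eqP o; rewrite prime_cyclic ?o.
rewrite -{2}(muln1 (p * q)) eqn_pmul2l ?muln_gt0 ?p_gt0 // => /eqP o.
by have /eqP -> : ((L / 'Z(L)) == 1)%g; rewrite ?cyclic1 // trivg_card1 o.
Qed.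

(** * The module [H] as functions modulo constants, and the fixed points of [alpha] *)

Section ShiftAndKernel.

Variable p : nat.
Hypothesis p_pr : prime p.

Let p_gt0 : 0 < p := prime_gt0 p_pr.
Let p_gt1 : 1 < p := prime_gt1 p_pr.
Let o0 : 'I_p := Ordinal p_gt0.

Lemma alphaXE k (i : 'I_p) : ((alpha p ^+ k)%g i : nat) = (i + k) %% p.
Proof.
rewrite permX; elim: k => [|k IH] /=; first by rewrite addn0 modn_small.
by rewrite permE /= IH -addn1 modnDml addn1 addnS.
Qed.

Lemma order_alpha : #[alpha p]%g = p.
Proof.
apply: nt_prime_order => //.
  by apply/permP=> i; apply: val_inj; rewrite /= alphaXE modnDr modn_small // perm1.
apply/eqP=> /permP/(_ o0)/(congr1 val); rewrite /= perm1 -[alpha p]expg1 alphaXE /=.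
by rewrite modn_small.
Qed.

Lemma card_Zp_type : #|'Z_p| = p.
Proof. by rewrite card_ord Zp_cast. Qed.

Lemma NgenX k j : ((\prod_(i < p) kgen i) ^+ k : vecK p)%g ord0 j = (k%:R : 'Z_p)%R.
Proof.
elim: k => [|k IH]; first by rewrite expg0 mxE.
by rewrite expgS mxE Ngen_entry IH -natr1 addrC.
Qed.

(** The generator of [Ngrp] is the all-ones vector, so its powers are the constants. *)
Lemma NgrpP (v : vecK p) :
  reflect (exists c : 'Z_p, forall j, v ord0 j = c) (v \in Ngrp p).
Proof.
apply: (iffP (cycleP _ _)) => [[k ->] | [c vc]].
  by exists (k%:R)%R => j; rewrite NgenX.
by exists c; apply/rowP=> j; rewrite NgenX vc natr_Zp.
Qed.

Lemma card_Ngrp : #|Ngrp p| = p.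
Proof.
apply: nt_prime_order => //.
  by apply/rowP=> j; rewrite NgenX mxE; apply: val_inj; rewrite /= val_Zp_nat // modnn.
apply/eqP => /rowP/(_ o0); rewrite Ngen_entry mxE => /eqP.
by rewrite oner_eq0.
Qed.

Lemma Ngrp_norm : [set: vecK p] \subset 'N(Ngrp p)%g.
Proof. exact: sub_abelian_norm (FinRing.zmod_abelian _) (subsetT _). Qed.

Lemma card_quotient_Ngrp : #|([set: vecK p] / Ngrp p)%g| = p ^ p.-1.
Proof.
rewrite card_quotient ?Ngrp_norm //.
rewrite -divgS ?subsetT // card_Ngrp cardsT card_mx card_Zp_type mul1n.
have -> : p ^ p = p * p ^ p.-1 by rewrite -expnS prednK.
by rewrite mulKn.
Qed.

(* The preimage in [K] of the fixed points of [g] on [K / N]. *)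
Definition fixed_mod_const (g : {perm 'I_p}) : {set vecK p} :=
  [set v : vecK p | [exists c : 'Z_p, forall j, (v ord0 j - v ord0 (g j))%R == c]].

Lemma fixed_mod_constP (g : {perm 'I_p}) (v : vecK p) :
  reflect (exists c : 'Z_p, forall j, (v ord0 j - v ord0 (g j))%R = c) (v \in fixed_mod_const g).
Proof.
rewrite inE; apply: (iffP existsP) => [[c /forallP vc]|[c vc]]; exists c.
  by move=> j; apply/eqP.
by apply/forallP=> j; apply/eqP.
Qed.

(** The coset of [v] is fixed when [permact v g] and [v] differ by a constant; at the index [g j]
    this difference reads [v j - v (g j)]. *)
Lemma mem_coset_gacent g (v : vecK p) :
  (coset (Ngrp p) v \in 'C_(|Haction p)[g])%g = (v \in fixed_mod_const g).
Proof.
have nN u : u \in 'N(Ngrp p)%g by apply: (subsetP Ngrp_norm); rewrite inE.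
have gD : g \in qact_dom (permact_gaction p) (Ngrp p) by rewrite (subsetP (qdom_full p)) ?inE.
have actE : Haction p (coset (Ngrp p) v) g = coset (Ngrp p) (permact v g).
  by rewrite /= (@qactE _ _ _ (permact_action p)).
rewrite gacent1E // in_setI mem_quotient ?in_setT //=.
apply/afix1P/fixed_mod_constP; rewrite actE.
  case/(kercoset_rcoset (nN _) (nN _)) => u /NgrpP[c uc] e.
  exists c => j; move/rowP: e => /(_ (g j)).
  by rewrite !mxE permK uc => ->; rewrite addrK.
case=> c vc; apply/rcoset_kercosetP; rewrite ?nN // mem_rcoset; apply/NgrpP; exists c => j.
by rewrite !mxE -(vc (g^-1 j)%g) permKV.
Qed.

Lemma card_gacent1 g n : #|fixed_mod_const g| = p * n -> #|'C_(|Haction p)[g]%g| = n.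
Proof.
move=> oE; have := card_cosetpre 'C_(|Haction p)[g]%G; rewrite card_Ngrp.
have -> : (coset (Ngrp p) @*^-1 'C_(|Haction p)[g])%g = fixed_mod_const g.
  apply/setP=> v; rewrite -mem_coset_gacent.
  apply/morphpreP/idP => [[] // | Cv]; split=> //.
  by apply: (subsetP Ngrp_norm); rewrite inE.
by rewrite oE => /eqP; rewrite eqn_pmul2l // => /eqP.
Qed.

Lemma Zp_natr_inj (i j : 'I_p) : (i%:R = j%:R :> 'Z_p)%R -> i = j.
Proof.
move=> /(congr1 val) /=; rewrite !val_Zp_nat // !modn_small //.
exact: val_inj.
Qed.

(** A function on [Z/p] whose difference along the shift is constant is affine. *)
Lemma fixed_mod_const_alphaP (v : vecK p) :
  reflect (exists cd : 'Z_p * 'Z_p, v = (\row_(j < p) (cd.1 + cd.2 * (j : nat)%:R))%R)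
    (v \in fixed_mod_const (alpha p)).
Proof.
apply: (iffP (fixed_mod_constP _ _)) => [[c vc] | [[d c] ->]]; last first.
  (* The sign is negative because the difference is taken as [v j] minus its successor; [Zp_nat_mod]
     absorbs the wrap-around at the last index. *)
  exists (- c)%R => j; rewrite !mxE -[alpha p]expg1 alphaXE Zp_nat_mod // addn1 -natr1.
  by rewrite mulrDr mulr1 opprD addrACA subrr add0r opprD addNKr.
exists (v ord0 o0, - c)%R; apply/rowP=> j; rewrite mxE /=.
have vX k : v ord0 ((alpha p ^+ k)%g o0) = (v ord0 o0 - c * k%:R)%R.
  elim: k => [|k IH]; first by rewrite expg0 perm1 mulr0 subr0.
  rewrite expgSr permM -natr1 mulrDr mulr1 opprD addrA -IH.
  by rewrite -(vc ((alpha p ^+ k)%g o0)) opprB addrC subrK.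
rewrite mulNr -vX; congr (v _ _); apply: val_inj.
by rewrite /= alphaXE add0n modn_small.
Qed.

Lemma card_gacent_alpha : #|'C_(|Haction p)[alpha p]%g| = p.
Proof.
apply: card_gacent1.
(* The values at 0 and 1 recover both coefficients, so there are [p * p] affine functions, that is
   [p] modulo constants. *)
pose f (cd : 'Z_p * 'Z_p) : vecK p := (\row_(j < p) (cd.1 + cd.2 * (j : nat)%:R))%R.
have -> : fixed_mod_const (alpha p) = f @: setT.
  apply/setP=> v; apply/fixed_mod_const_alphaP/imsetP => [[cd ->] | [cd _ ->]]; by exists cd.
rewrite card_imset ?cardsT ?card_prod ?card_Zp_type // => [[c d] [c' d']] /rowP e.
have := e o0; rewrite !mxE /= !mulr0 !addr0 => cc; subst c'.
by have := e (Ordinal p_gt1); rewrite !mxE /= !mulr1 => /addrI ->.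
Qed.

(** * Fixed points of [beta], and of [alpha] and [beta] jointly *)

Section TwoOrbits.

Variables (q : nat) (beta : {perm 'I_p}).
Hypotheses (q_gt1 : 1 < q) (p_eq : p = (2 * q).+1).
Hypothesis beta_fix1 : forall i : 'I_p, val i = 0 -> beta i = i.
Hypothesis beta_cycles : forall i : 'I_p, val i != 0 -> #|porbit beta i| = q.

Let o1 : 'I_p := Ordinal p_gt1.

Lemma order_beta : prime q -> #[beta]%g = q.
Proof.
move=> q_pr; apply: nt_prime_order => //.
  apply/permP=> i; rewrite perm1 permX; have [i0 | i0] := eqVneq (val i) 0.
    by elim: (q) => //= n ->; apply: beta_fix1.
  by rewrite -{1}(beta_cycles i0) iter_porbit.
apply/eqP=> b1; have := beta_cycles (i := o1) isT.
rewrite b1 (_ : porbit _ _ = [set o1]) ?cards1; first by move=> q1; have := q_gt1; rewrite -q1.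
apply/setP=> j; apply/porbitP/set1P => [[k ->] | ->]; first by rewrite expg1n perm1.
by exists 0; rewrite perm1.
Qed.

Lemma beta_moves_1 : beta o1 != o1.
Proof.
apply/eqP=> b1; have := beta_cycles (i := o1) isT; rewrite (_ : porbit _ _ = [set o1]) ?cards1.
  by move=> q1; have := q_gt1; rewrite -q1.
apply/setP=> j; apply/porbitP/set1P => [[k ->] | ->]; last by exists 0; rewrite perm1.
by rewrite permX; elim: k => //= k ->.
Qed.

(** Evaluating at the fixed point 0 of [beta] forces the constant to vanish. *)
Lemma fixed_mod_const_betaP (v : vecK p) :
  reflect (forall j, v ord0 (beta j) = v ord0 j) (v \in fixed_mod_const beta).
Proof.
apply: (iffP (fixed_mod_constP _ _)) => [[c vc] j | vb]; last first.
  by exists 0%R => j; rewrite vb subrr.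
by apply/esym/eqP; rewrite -subr_eq0 vc -(vc o0) beta_fix1 // subrr.
Qed.

Lemma card_fixed_mod_const_beta : #|fixed_mod_const beta| = p ^ 3.
Proof.
(* The point [m] represents the second long orbit; it exists because [1 + q < p]. *)
have [m m0 mO] : exists2 m : 'I_p, val m != 0 & m \notin porbit beta o1.
  have: ~~ ([set: 'I_p] \subset o0 |: porbit beta o1).
    apply/negP=> /subset_leq_card; rewrite cardsT card_ord leqNgt; case/negP.
    apply: leq_ltn_trans (leq_card_setU _ _) _.
    by rewrite cards1 (beta_cycles (i := o1) isT) p_eq add1n ltnS mul2n -addnn -{1}(addn0 q) ltn_add2l ltnW.
  case/subsetPn=> m _; rewrite in_setU1 negb_or => /andP[m0 mO]; by exists m.
have O0 (i j : 'I_p) : val i != 0 -> j \in porbit beta i -> val j != 0.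
  move=> i0 /porbitP[k ->]; apply: contra i0 => /eqP ki0.
  have fixk n : (beta ^+ n)%g ((beta ^+ k)%g i) = (beta ^+ k)%g i.
    by rewrite permX; elim: n => //= n ->; apply: beta_fix1.
  by move/perm_inj: (fixk k) => <-; apply/eqP.
(* The three orbits are disjoint and their sizes add up to [1 + q + q = p]. *)
have cover j : [|| j == o0, j \in porbit beta o1 | j \in porbit beta m].
  have dis1m : [disjoint porbit beta o1 & porbit beta m].
    rewrite disjoint_subset; apply/subsetP=> i i1; rewrite inE; apply: contra mO => im.
    by rewrite porbit_sym in im; rewrite -eq_porbit_mem in i1; rewrite -(eqP i1).
  have: o0 |: (porbit beta o1 :|: porbit beta m) = [set: 'I_p].
    apply/eqP; rewrite eqEcard subsetT cardsT card_ord cardsU1 cardsU.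
    rewrite (eqP (_ : _ :&: _ == set0)) ?setI_eq0 // cards0 subn0 !beta_cycles //.
    rewrite in_setU negb_or.
    have -> : o0 \notin porbit beta o1 by apply/negP=> /O0; case/(_ isT)/negP.
    have -> : o0 \notin porbit beta m by apply/negP=> /O0; case/(_ m0)/negP.
    by rewrite /= addnn -mul2n add1n -p_eq.
  by move/setP/(_ j); rewrite !inE.
(* An invariant function is given by its values on the three orbits; by [cover], the last branch is
   the orbit of [m]. *)
pose f (t : 'Z_p * 'Z_p * 'Z_p) : vecK p :=
  (\row_(j < p) if j == o0 then t.1.1 else if j \in porbit beta o1 then t.1.2 else t.2)%R.
have constO (v : vecK p) : v \in fixed_mod_const beta ->
    forall i j, j \in porbit beta i -> v ord0 j = v ord0 i.
  move=> /fixed_mod_const_betaP vb i j /porbitP[k ->]; rewrite permX.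
  by elim: k => //= k <-; rewrite vb.
have m_o0 : m == o0 = false by apply/negbTE.
have -> : fixed_mod_const beta = f @: setT.
  apply/setP=> v; apply/idP/imsetP => [vE | [[[x y] z] _ ->]].
    exists (v ord0 o0, v ord0 o1, v ord0 m) => //; apply/rowP=> j; rewrite mxE /=.
    have := cover j; case: eqP => [-> // | _] /=; case: ifP => [jO _ | _ /= jO]; exact: constO.
  apply/fixed_mod_const_betaP=> j; rewrite !mxE /=.
  have -> : (beta j == o0) = (j == o0).
    by rewrite -{1}(beta_fix1 (i := o0) erefl) (inj_eq perm_inj).
  have -> // : (beta j \in porbit beta o1) = (j \in porbit beta o1).
  by have := porbit_perm beta 1 j; rewrite expg1 -!eq_porbit_mem => ->.
rewrite card_imset => [|[[x y] z] [[x' y'] z'] /rowP e].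
  by rewrite cardsT !card_prod card_Zp_type !expnS expn0 muln1 mulnA.
have := e o0; rewrite !mxE /= => ->.
have := e o1; rewrite !mxE /= porbit_id => ->.
by have := e m; rewrite !mxE /= m_o0 (negPf mO) => ->.
Qed.

Lemma card_gacent_beta : #|'C_(|Haction p)[beta]%g| = p ^ 2.
Proof. by apply: card_gacent1; rewrite card_fixed_mod_const_beta. Qed.

(** Let [d + c * j] be invariant under [beta]. Comparing the indices 1 and [beta 1] shows that a
    nonzero slope [c], being a unit, would make [beta] fix 1; so the function is constant. *)
Lemma gacent_alpha_beta : ('C_(|Haction p)[alpha p] :&: 'C_(|Haction p)[beta] = 1)%g.
Proof.
apply/trivgP/subsetP=> u; case: (cosetP u) => v nNv ->.
rewrite in_setI !mem_coset_gacent => /andP[/fixed_mod_const_alphaP[[d c] def_v] /fixed_mod_const_betaP vb].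
have c0 : c = 0%R.
  apply/eqP; apply: contraT => c0; case/eqP: beta_moves_1; apply: Zp_natr_inj.
  have Uc : c \is a GRing.unit.
    rewrite -(natr_Zp c) unitZpE // prime_coprime // gtnNdvd ?lt0n //.
    by rewrite -{2}(Zp_cast p_gt1) ltn_ord.
  by have := vb o1; rewrite def_v !mxE /= => /addrI/(mulrI Uc).
rewrite inE; apply/eqP/coset_id/NgrpP; exists d => j.
by rewrite def_v mxE c0 /= mul0r addr0.
Qed.

End TwoOrbits.

End ShiftAndKernel.

(* Indices 1..p of the paper are represented by the ordinals 0..p-1 of 'I_p
   (index i of the paper <-> ordinal i-1). *)
Theorem theorem1 (p q : nat) (p_pr : prime p) (q_pr : prime q)
  (p_eq : p = (2 * q).+1)
  (beta : {perm 'I_p})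
  (beta_fix1 : forall i : 'I_p, val i = 0 -> beta i = i)
  (beta_cycles : forall i : 'I_p, val i != 0 -> #|porbit beta i| = q)
  (r : nat) (r_gt1 : 1 < r) (r_ltq : r < q) (r_ord : r ^ q = 1 %[mod p])
  (conj_ab : (alpha p ^ beta = alpha p ^+ r)%g) :
  class_sizes (Ggrp beta) =i set_prod [:: 1; p; p ^ (p - 2)] [:: 1; q]
  /\ ('Z(Ggrp beta) = 1)%g.
Proof.
have q_gt1 := prime_gt1 q_pr.
have q_ltp : q < p by rewrite p_eq ltnS leq_pmull.
have p_gt4 : 4 < p by rewrite p_eq ltnS (@leq_pmul2l 2 2).
have oa := order_alpha p_pr.
have ob : #[beta]%g = q by apply: order_beta.
have nab : (<[beta]> \subset 'N(<[alpha p]>))%g.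
  by rewrite cycle_subG inE -cycleJ conj_ab cycleX.
have oAB : #|ABgrp beta| = p * q.
  rewrite /= norm_joinEr // coprime_cardMg -?orderE oa ob //.
  by rewrite prime_coprime // dvdn_prime2 // neq_ltn q_ltp orbT.
have sA : <[alpha p]>%g \subset ABgrp beta := joing_subl _ _.
have sB : <[beta]>%g \subset ABgrp beta := joing_subr _ _.
have ZAB : ('Z(ABgrp beta) = 1)%g.
  (* If [alpha] and [beta] commuted, then [alpha = alpha ^+ r], impossible for [1 < r < p]. *)
  apply: (nonabelian_pq_center p_pr q_pr oAB).
  apply/negP=> /centsP cAB.
  have cab : commute (alpha p) beta.
    by apply: cAB; [apply: (subsetP sA) | apply: (subsetP sB)]; apply: cycle_id.
  have /eqP := conj_ab; rewrite /conjg cab mulKg -{1}(expg1 (alpha p)).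
  rewrite eq_expg_mod_order oa !modn_small ?(ltn_trans r_ltq) ?prime_gt1 //.
  by case: (r) r_gt1 => [|[]].
pose to := Hact beta.
(* This transfers centralizers inside the semidirect product to fixed points of the action on
   [K / N], where they have been counted. *)
have CE (X : {group {perm 'I_p}}) : X \subset ABgrp beta ->
    ('C_(sdpair1 to @* ([set: vecK p] / Ngrp p))(sdpair2 to @* X)
     = sdpair1 to @* 'C_(|Haction p)(X))%g.
  move=> sX; rewrite -{2}(setIidPr sX) -(gacent_ract _ (subset_trans (subsetT (ABgrp beta)) (qdom_full p))).
  by rewrite gacentEsd -morphpreIim morphpreK ?subsetIl.
have sR (X : {set _}) : ('C_(|Haction p)(X) \subset [set: vecK p] / Ngrp p)%g by apply: subsetIl.
have inj1 := injm_sdpair1 to; have inj2 := injm_sdpair2 to.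
have dom g : g \in qact_dom (permact_action p) (Ngrp p).
  by apply: (subsetP (qdom_full p)); rewrite inE.
have domS (X : {set {perm 'I_p}}) : X \subset qact_dom (permact_action p) (Ngrp p).
  by apply: subset_trans (qdom_full p); apply: subsetT.
have defG := sdprod_sdpair to.
have oH1 : #|(sdpair1 to @* ([set: vecK p] / Ngrp p))%g| = p ^ p.-1.
  by rewrite card_injm // card_quotient_Ngrp.
have abH : abelian (sdpair1 to @* ([set: vecK p] / Ngrp p))%g.
  by rewrite morphim_abelian // quotient_abelian // FinRing.zmod_abelian.
have oL : #|(sdpair2 to @* ABgrp beta)%g| = p * q by rewrite card_injm.
have ZL : ('Z(sdpair2 to @* ABgrp beta) = 1)%g.
  by rewrite -injm_center // ZAB morphim1.
have oA : #|(sdpair2 to @* <[alpha p]>)%g| = p by rewrite card_injm.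
have oB : #|(sdpair2 to @* <[beta]>)%g| = q by rewrite card_injm.
have oCA : #|'C_(sdpair1 to @* ([set: vecK p] / Ngrp p))(sdpair2 to @* <[alpha p]>)%g| = p.
  by rewrite CE // card_injm // gacent_cycle ?dom // card_gacent_alpha.
have oCB : #|'C_(sdpair1 to @* ([set: vecK p] / Ngrp p))(sdpair2 to @* <[beta]>)%g| = p ^ 2.
  by rewrite CE // card_injm // gacent_cycle ?dom // (card_gacent_beta p_pr _ p_eq).
have CL : ('C_(sdpair1 to @* ([set: vecK p] / Ngrp p))(sdpair2 to @* ABgrp beta) = 1)%g.
  (* The fixed points of the join are the intersection of those of [alpha] and [beta]. *)
  rewrite CE // gacentY ?domS // !gacent_cycle ?dom //.
  by rewrite (gacent_alpha_beta p_pr q_gt1) ?morphim1.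
have sA2 := morphimS (sdpair2_morphism to) sA.
have sB2 := morphimS (sdpair2_morphism to) sB.
split.
  exact: (class_sizes_sdprod p_pr q_pr p_gt4 q_ltp defG abH oH1 oL ZL sA2 oA oCA sB2 oB oCB CL).
exact: (center_sdprod p_pr q_pr p_gt4 q_ltp defG abH oH1 oL ZL sA2 oA oCA sB2 oB oCB CL).
Qed.
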